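(* Let $\mathcal{C}$ be a small preadditive category, $\mathcal{I}$ an ideal in $\mathcal{C}$ and $\pi:\mathcal{C}\to\mathcal{C}/\mathcal{I}$ the canonical functor. Put $\pi^{\ast}:=\frac{\mathcal{C}}{\mathcal{I}}\otimes_{\mathcal{C}}-:\mathrm{Mod}(\mathcal{C})\to\mathrm{Mod}(\mathcal{C}/\mathcal{I})$ and $\pi^{!}:=\mathcal{C}(\frac{\mathcal{C}}{\mathcal{I}},-):\mathrm{Mod}(\mathcal{C})\to\mathrm{Mod}(\mathcal{C}/\mathcal{I})$. Then $(\pi^{\ast},\pi_{\ast})$ and $(\pi_{\ast},\pi^{!})$ are adjoint pairs, and $\pi^{!}\simeq\overline{\mathrm{Tr}}_{\frac{\mathcal{C}}{\mathcal{I}}}$.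
   Context: $\mathrm{Mod}(\mathcal{C})$ is the category of additive covariant functors $\mathcal{C}\to\mathbf{Ab}$. An ideal $\mathcal{I}$ of $\mathcal{C}$ is a family of subgroups $\mathcal{I}(A,B)\subseteq \mathrm{Hom}_{\mathcal{C}}(A,B)$ closed under composition on either side with arbitrary morphisms of $\mathcal{C}$. The quotient category $\mathcal{C}/\mathcal{I}$ has the same objects as $\mathcal{C}$ and $\mathrm{Hom}_{\mathcal{C}/\mathcal{I}}(A,B)=\mathrm{Hom}_{\mathcal{C}}(A,B)/\mathcal{I}(A,B)$; $\pi_{\ast}:\mathrm{Mod}(\mathcal{C}/\mathcal{I})\to\mathrm{Mod}(\mathcal{C})$ is $\pi_{\ast}(F)=F\circ\pi$. $\otimes_{\mathcal{C}}:\mathrm{Mod}(\mathcal{C}^{op})\times\mathrm{Mod}(\mathcal{C})\to\mathbf{Ab}$ is the usual tensor product of functors: it is right exact and coproduct-preserving in each variable, with $A\otimes_{\mathcal{C}}\mathrm{Hom}_{\mathcal{C}}(C,-)=A(C)$ and $\mathrm{Hom}_{\mathcal{C}}(-,C)\otimes_{\mathcal{C}}B=B(C)$. For $M\in\mathrm{Mod}(\mathcal{C})$ and $C\in\mathcal{C}/\mathcal{I}$, $\left(\frac{\mathcal{C}}{\mathcal{I}}\otimes_{\mathcal{C}}M\right)(C)=\frac{\mathcal{C}(-,C)}{\mathcal{I}(-,C)}\otimes_{\mathcal{C}}M$ and $\mathcal{C}(\frac{\mathcal{C}}{\mathcal{I}},M)(C)=\mathrm{Hom}_{\mathrm{Mod}(\mathcal{C})}\left(\frac{\mathcal{C}(C,-)}{\mathcal{I}(C,-)},M\right)$,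 with the evident action on morphisms. For $C\in\mathcal{C}$ put $M_{C}=\mathrm{Hom}_{\mathcal{C}}(C,-)/\mathcal{I}(C,-)$. $\mathrm{Tr}_{\frac{\mathcal{C}}{\mathcal{I}}}(G)\subseteq G$ is the trace of the family $\{M_C\}_{C\in\mathcal{C}}$ in $G$, i.e. the image of the canonical morphism $M^{(\Lambda)}\to G$, where $M=\bigoplus_C M_C$ and $\Lambda=\mathrm{Hom}_{\mathrm{Mod}(\mathcal{C})}(M,G)$. It lies in $\mathrm{Ann}(\mathcal{I})=\{F : F(f)=0\ \forall f\in\mathcal{I}\}$. With $\Omega:\mathrm{Ann}(\mathcal{I})\to\mathrm{Mod}(\mathcal{C}/\mathcal{I})$ the inverse of $\pi_{\ast}:\mathrm{Mod}(\mathcal{C}/\mathcal{I})\to\mathrm{Ann}(\mathcal{I})$, set $\overline{\mathrm{Tr}}_{\frac{\mathcal{C}}{\mathcal{I}}}=\Omega\circ\mathrm{Tr}_{\frac{\mathcal{C}}{\mathcal{I}}}$. *)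

(* Defs.v *)
From HB Require Import structures.
From mathcomp Require Import all_boot all_algebra.
From mathcomp Require Import boolp classical_sets functions cardinality fsbigop.
From mathcomp Require Import freeg.

Set Implicit Arguments.
Unset Strict Implicit.
Unset Printing Implicit Defensive.

Import GRing.Theory.

Local Open Scope classical_set_scope.
Local Open Scope ring_scope.
Local Open Scope quotient_scope.

(* Everything is classical: the choiceType structure required by zmodType is
   obtained from the axiom of choice where it is not already available, so that
   a zmodType is an arbitrary (small) abelian group and a zmodClosed an
   arbitrary subgroup. *)

Lemma additive_ext (U V : zmodType) (f g : {additive U -> V}) :
  (forall x, f x = g x) -> f = g.
Proof.
case: f => f [[f0]]; case: g => g [[g0]] /= /funext fg.
by case: _ / fg g0 => g0; congr (GRing.Additive.Pack (GRing.Additive.Class _));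
  congr (GRing.isNmodMorphism.Axioms_ _); exact: Prop_irrelevance.
Qed.

Section AddMap.
Context (U V : zmodType) (f : U -> V) (fD : forall x y, f (x + y) = f x + f y).

Fact addmap_subproof : zmod_morphism f.
Proof.
move=> x y; apply/eqP; rewrite -subr_eq opprK -fD.
by rewrite subrK.
Qed.

Definition addmap : {additive U -> V} :=
  HB.pack_for {additive U -> V} f (GRing.isZmodMorphism.Build U V f addmap_subproof).

End AddMap.
Arguments addmap {U V}.

Section SubgroupType.
Context (V : zmodType) (S : zmodClosed V).

Definition subgroup : Type := {x : V | x \in S}.
HB.instance Definition _ := SubType.on subgroup.
HB.instance Definition _ := Choice.on subgroup.
HB.instance Definition _ := [SubChoice_isSubZmodule of subgroup by <:].

End SubgroupType.

Section Corestr.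
Context (U V : zmodType) (S : zmodClosed V) (f : {additive U -> V}).
Hypothesis fS : forall x, f x \in S.

Definition corestr_fun x : subgroup S := exist (fun y => y \in S) (f x) (fS x).

Fact corestrD x y : corestr_fun (x + y) = corestr_fun x + corestr_fun y.
Proof. by apply: val_inj; rewrite /= raddfD. Qed.

Definition corestr : {additive U -> subgroup S} := addmap corestr_fun corestrD.

End Corestr.

Section Image.
Context (U V : zmodType) (f : {additive U -> V}).

Definition image_pred : {pred V} := fun y => `[< exists x, f x = y >].

Fact image_zmod_closed : zmod_closed image_pred.
Proof.
split=> [|y z /asboolP[u fu] /asboolP[v fv]]; apply/asboolP.
  by exists 0; rewrite raddf0.
by exists (u - v); rewrite raddfB fu fv.
Qed.
HB.instance Definition _ := GRing.isZmodClosed.Build V image_pred image_zmod_closed.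

Definition image_sub : zmodClosed V := image_pred.

Lemma image_subP y : reflect (exists x, f x = y) (y \in image_sub).
Proof. exact: asboolP. Qed.

End Image.

Section Generated.
Context (V : zmodType) (S : V -> Prop).

Definition gen_pred : {pred V} := fun x =>
  `[< forall K : zmodClosed V, (forall y, S y -> y \in K) -> x \in K >].

Fact gen_zmod_closed : zmod_closed gen_pred.
Proof.
split=> [|x y /asboolP Sx /asboolP Sy]; apply/asboolP => K SK.
  exact: rpred0.
by apply: rpredB; [exact: Sx | exact: Sy].
Qed.
HB.instance Definition _ := GRing.isZmodClosed.Build V gen_pred gen_zmod_closed.

Definition gen_sub : zmodClosed V := gen_pred.

Lemma mem_gen_sub x : S x -> x \in gen_sub.
Proof. by move=> Sx; apply/asboolP => K; apply. Qed.

Lemma gen_sub_ker (W : zmodType) (f : {additive V -> W}) :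
  (forall x, S x -> f x = 0) -> forall x, x \in gen_sub -> f x = 0.
Proof.
move=> f0 x /asboolP Sx.
pose K : {pred V} := fun y => f y == 0.
have KP : zmod_closed K.
  split=> [|y z]; rewrite !unfold_in /K ?raddf0// => /eqP fy /eqP fz.
  by rewrite raddfB fy fz subr0.
pose KC : zmodClosed V := HB.pack K (GRing.isZmodClosed.Build V K KP).
by apply/eqP; apply: (Sx KC) => y /f0 fy; apply/eqP.
Qed.

End Generated.

Section Quotient.
Context (V : zmodType) (S : zmodClosed V).

Definition qproj : {additive V -> Quotient.quot S} :=
  addmap (fun x => \pi_(Quotient.quot S) x) (@Quotient.pi_add V S).

Lemma qprojK (q : Quotient.quot S) : qproj (repr q) = q.
Proof. exact: reprK. Qed.

Lemma qproj_eq x y : qproj x = qproj y <-> x - y \in S.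
Proof. by rewrite Quotient.idealrBE; split=> /eqP. Qed.

Context (W : zmodType) (f : {additive V -> W}).
Hypothesis fS : forall x, x \in S -> f x = 0.

Definition qlift_fun (q : Quotient.quot S) : W := f (repr q).

Lemma qlift_funE x : qlift_fun (qproj x) = f x.
Proof.
apply/eqP; rewrite -subr_eq0 -raddfB; apply/eqP/fS.
by apply/qproj_eq; rewrite qprojK.
Qed.

Fact qlift_funD p q : qlift_fun (p + q) = qlift_fun p + qlift_fun q.
Proof. by rewrite -[p]qprojK -[q]qprojK -raddfD !qlift_funE raddfD. Qed.

Definition qlift : {additive Quotient.quot S -> W} := addmap qlift_fun qlift_funD.

Lemma qliftE x : qlift (qproj x) = f x.
Proof. exact: qlift_funE. Qed.

End Quotient.

Section DirectSum.
Context (I : choiceType) (T : I -> zmodType).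

Record dsum := DSum {
  dsum_val :> forall i, T i;
  dsum_fin : finite_set [set i | dsum_val i != 0]
}.

Lemma dsum_ext (x y : dsum) : (forall i, x i = y i) -> x = y.
Proof.
case: x y => [x xf] [y yf] /= xy.
have exy : x = y by apply: functional_extensionality_dep.
by subst y; congr DSum; exact: Prop_irrelevance.
Qed.

HB.instance Definition _ := gen_eqMixin dsum.
HB.instance Definition _ := gen_choiceMixin dsum.

Fact dsum0_fin : finite_set [set i | (0 : T i) != 0].
Proof. by apply: (sub_finite_set _ (finite_set0 _)) => i /=; rewrite eqxx. Qed.

Fact dsumD_fin (x y : dsum) : finite_set [set i | x i + y i != 0].
Proof.
apply: sub_finite_set (_ : finite_set ([set i | x i != 0] `|` [set i | y i != 0])).
  move=> i /=; case: (eqVneq (x i) 0) => [->|]; last by left.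
  by rewrite add0r; right.
by rewrite finite_setU; split; exact: dsum_fin.
Qed.

Fact dsumN_fin (x : dsum) : finite_set [set i | - x i != 0].
Proof.
by apply: sub_finite_set (dsum_fin x) => i /=; rewrite oppr_eq0.
Qed.

Definition dsum0 : dsum := DSum dsum0_fin.
Definition dsumD (x y : dsum) : dsum := DSum (dsumD_fin x y).
Definition dsumN (x : dsum) : dsum := DSum (dsumN_fin x).

Fact dsumDA : associative dsumD.
Proof. by move=> x y z; apply: dsum_ext => i /=; rewrite addrA. Qed.
Fact dsumDC : commutative dsumD.
Proof. by move=> x y; apply: dsum_ext => i /=; rewrite addrC. Qed.
Fact dsum0D : left_id dsum0 dsumD.
Proof. by move=> x; apply: dsum_ext => i /=; rewrite add0r. Qed.
Fact dsumND : left_inverse dsum0 dsumN dsumD.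
Proof. by move=> x; apply: dsum_ext => i /=; rewrite addNr. Qed.
HB.instance Definition _ := GRing.isZmodule.Build dsum dsumDA dsumDC dsum0D dsumND.

Fact dsum_in_fin i (x : T i) :
  finite_set [set j | dfwith (fun j => 0 : T j) x j != 0].
Proof.
apply: (sub_finite_set _ (finite_set1 i)) => j /=.
by case: dfwithP => // k _; rewrite eqxx.
Qed.

Definition dsum_in i (x : T i) : dsum := DSum (dsum_in_fin x).

Section Desc.
Context (V : zmodType) (f : forall i, {additive T i -> V}).

Definition dsum_desc_fun (x : dsum) : V :=
  (\sum_(i \in [set: I]) f i (x i))%R.

Lemma dsum_desc_widen (x : dsum) (A : set I) : finite_set A ->
  [set i | x i != 0] `<=` A -> dsum_desc_fun x = (\sum_(i \in A) f i (x i))%R.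
Proof.
move=> fA xA; apply/esym/fsbig_widen => // i [_ nA] /=.
by apply: contra_notP nA => fx; apply: xA => /=; apply/eqP => x0;
  apply: fx; rewrite x0 raddf0.
Qed.

Fact dsum_desc_funD (x y : dsum) :
  dsum_desc_fun (x + y) = dsum_desc_fun x + dsum_desc_fun y.
Proof.
pose A := [set i | x i != 0] `|` [set i | y i != 0].
have fA : finite_set A by rewrite finite_setU; split; exact: dsum_fin.
rewrite !(@dsum_desc_widen _ A)//.
- by rewrite -fsbig_split//=; apply: eq_fsbigr => i _; rewrite raddfD.
- by move=> i; right.
- by move=> i; left.
- move=> i /=; case: (eqVneq (x i) 0) => [->|]; last by left.
  by rewrite add0r; right.
Qed.

Definition dsum_desc : {additive dsum -> V} := addmap dsum_desc_fun dsum_desc_funD.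

Lemma dsum_desc_in i (x : T i) : dsum_desc (dsum_in x) = f i x.
Proof.
rewrite /= (@dsum_desc_widen _ [set i])//.
- by rewrite fsbig_set1 /= dfwith_in.
- move=> j /=; case: dfwithP => // k _; by rewrite eqxx.
Qed.

End Desc.
End DirectSum.
Arguments dsum {I}.

Section DirectSumMap.
Context (I : choiceType) (T T' : I -> zmodType) (f : forall i, {additive T i -> T' i}).

Fact dsum_map_fin (x : dsum T) : finite_set [set i | f i (x i) != 0].
Proof.
by apply: sub_finite_set (dsum_fin x) => i /=; apply: contra_neq => ->; exact: raddf0.
Qed.

Definition dsum_map_fun (x : dsum T) : dsum T' := DSum (dsum_map_fin x).

Fact dsum_map_funD x y : dsum_map_fun (x + y) = dsum_map_fun x + dsum_map_fun y.
Proof. by apply: dsum_ext => i /=; rewrite raddfD. Qed.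

Definition dsum_map : {additive dsum T -> dsum T'} :=
  addmap dsum_map_fun dsum_map_funD.

End DirectSumMap.

Record preadditive := Preadditive {
  pob :> Type;
  phom : pob -> pob -> zmodType;
  pid : forall A, phom A A;
  pcomp : forall A B D, phom B D -> phom A B -> phom A D;
  pcompA : forall A B D E (h : phom D E) (g : phom B D) (f : phom A B),
    pcomp h (pcomp g f) = pcomp (pcomp h g) f;
  pcomp1f : forall A B (f : phom A B), pcomp (pid B) f = f;
  pcompf1 : forall A B (f : phom A B), pcomp f (pid A) = f;
  pcompDl : forall A B D (g g' : phom B D) (f : phom A B),
    pcomp (g + g') f = pcomp g f + pcomp g' f;
  pcompDr : forall A B D (g : phom B D) (f f' : phom A B),
    pcomp g (f + f') = pcomp g f + pcomp g f'
}.
Arguments phom {p}.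
Arguments pid {p}.
Arguments pcomp {p A B D}.

Definition opcat (C : preadditive) : preadditive :=
  @Preadditive C (fun A B => phom B A) pid (fun A B D g f => pcomp f g)
    (fun A B D E h g f => esym (pcompA f g h))
    (fun A B f => pcompf1 f) (fun A B f => pcomp1f f)
    (fun A B D g g' f => pcompDr f g g') (fun A B D g f f' => pcompDl f f' g).

Definition postcomp (C : preadditive) (A B D : C) (g : phom B D) :
    {additive phom A B -> phom A D} :=
  addmap (pcomp g) (pcompDr g).

Definition precomp (C : preadditive) (A B D : C) (f : phom A B) :
    {additive phom B D -> phom A D} :=
  addmap (fun g => pcomp g f) (fun g g' => pcompDl g g' f).

Record addfunctor (C D : preadditive) := AddFunctor {
  afob :> C -> D;
  afmap : forall A B, {additive phom A B -> phom (afob A) (afob B)};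
  afmap1 : forall A, afmap A A (pid A) = pid (afob A);
  afmapM : forall A B E (g : phom B E) (f : phom A B),
    afmap A E (pcomp g f) = pcomp (afmap B E g) (afmap A B f)
}.
Arguments afmap {C D} a {A B}.

Definition opfunctor (C D : preadditive) (F : addfunctor C D) :
    addfunctor (opcat C) (opcat D) :=
  @AddFunctor (opcat C) (opcat D) F (fun A B => @afmap C D F B A) (afmap1 F)
    (fun A B E g f => afmapM F f g).

Record ideal (C : preadditive) := Ideal {
  idl :> forall A B : C, zmodClosed (phom A B);
  idl_postcomp : forall (A B D : C) (g : phom B D) (f : phom A B),
    f \in idl A B -> pcomp g f \in idl A D;
  idl_precomp : forall (A B D : C) (g : phom B D) (f : phom A B),
    g \in idl B D -> pcomp g f \in idl A D
}.

Section QuotientCategory.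
Context (C : preadditive) (I : ideal C).

Definition quot_hom (A B : C) : zmodType := Quotient.quot (I A B).

Definition quot_comp (A B D : C) (q : quot_hom B D) (p : quot_hom A B) :
  quot_hom A D := qproj (I A D) (pcomp (repr q) (repr p)).

Lemma quot_compE A B D (g : phom B D) (f : phom A B) :
  quot_comp (qproj (I B D) g) (qproj (I A B) f) = qproj (I A D) (pcomp g f).
Proof.
apply/qproj_eq.
set g' := repr _; set f' := repr _.
have Ig : g' - g \in I B D by apply/qproj_eq; rewrite qprojK.
have If : f' - f \in I A B by apply/qproj_eq; rewrite qprojK.
have -> : pcomp g' f' - pcomp g f = pcomp (g' - g) f' + pcomp g (f' - f).
  rewrite -[pcomp (g' - g) f']/(precomp _ f' (g' - g)).
  rewrite -[pcomp g (f' - f)]/(postcomp _ g (f' - f)) !raddfB /=.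
  by rewrite addrA subrK.
by apply: rpredD; [exact: idl_precomp | exact: idl_postcomp].
Qed.

Fact quot_compA A B D E (h : quot_hom D E) (g : quot_hom B D) (f : quot_hom A B) :
  quot_comp h (quot_comp g f) = quot_comp (quot_comp h g) f.
Proof.
by rewrite -[h]qprojK -[g]qprojK -[f]qprojK !quot_compE pcompA.
Qed.

Fact quot_comp1f A B (f : quot_hom A B) : quot_comp (qproj (I B B) (pid B)) f = f.
Proof. by rewrite -[f]qprojK quot_compE pcomp1f. Qed.

Fact quot_compf1 A B (f : quot_hom A B) : quot_comp f (qproj (I A A) (pid A)) = f.
Proof. by rewrite -[f]qprojK quot_compE pcompf1. Qed.

Fact quot_compDl A B D (g g' : quot_hom B D) (f : quot_hom A B) :
  quot_comp (g + g') f = quot_comp g f + quot_comp g' f.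
Proof.
rewrite -[g]qprojK -[g']qprojK -[f]qprojK -raddfD !quot_compE -raddfD.
by rewrite pcompDl.
Qed.

Fact quot_compDr A B D (g : quot_hom B D) (f f' : quot_hom A B) :
  quot_comp g (f + f') = quot_comp g f + quot_comp g f'.
Proof.
rewrite -[g]qprojK -[f']qprojK -[f]qprojK -raddfD !quot_compE -raddfD.
by rewrite pcompDr.
Qed.

Definition quot_cat : preadditive :=
  @Preadditive C quot_hom (fun A => qproj (I A A) (pid A)) quot_comp
    quot_compA quot_comp1f quot_compf1 quot_compDl quot_compDr.

Definition quot_functor : addfunctor C quot_cat :=
  @AddFunctor C quot_cat (fun A => A) (fun A B => qproj (I A B))
    (fun A => erefl) (fun A B E g f => esym (quot_compE g f)).

End QuotientCategory.

Record Mod (C : preadditive) := MkMod {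
  mob :> C -> zmodType;
  mmap : forall A B : C, phom A B -> {additive mob A -> mob B};
  mmap1 : forall A x, mmap (pid A) x = x;
  mmapM : forall A B D (g : phom B D) (f : phom A B) x,
    mmap (pcomp g f) x = mmap g (mmap f x);
  mmapD : forall A B (f g : phom A B) x, mmap (f + g) x = mmap f x + mmap g x
}.
Arguments mmap {C} m {A B}.

Lemma mmap0 (C : preadditive) (M : Mod C) (A B : C) x :
  mmap M (0 : phom A B) x = 0.
Proof. by apply: (addIr (mmap M (0 : phom A B) x)); rewrite -mmapD !add0r. Qed.

Lemma Mod_ext (C : preadditive) (F : C -> zmodType)
    (m m' : forall A B : C, phom A B -> {additive F A -> F B}) h1 hM hD h1' hM' hD' :
  (forall A B (f : phom A B) x, m A B f x = m' A B f x) ->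
  @MkMod C F m h1 hM hD = @MkMod C F m' h1' hM' hD'.
Proof.
move=> mm'; have e : m = m'.
  apply: functional_extensionality_dep => A.
  apply: functional_extensionality_dep => B.
  by apply: funext => f; apply: additive_ext => x; exact: mm'.
by subst m'; congr MkMod; exact: Prop_irrelevance.
Qed.

Record modhom (C : preadditive) (M N : Mod C) := ModHom {
  mh :> forall A, {additive M A -> N A};
  mh_nat : forall A B (f : phom A B) x, mh B (mmap M f x) = mmap N f (mh A x)
}.

Section ModHom.
Context (C : preadditive) (M N : Mod C).

Lemma modhom_ext (s t : modhom M N) : (forall A x, s A x = t A x) -> s = t.
Proof.
case: s t => [s sn] [t tn] /= st.
have est : s = t.
  by apply: functional_extensionality_dep => A; apply: additive_ext => x; exact: st.
by subst t; congr ModHom; exact: Prop_irrelevance.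
Qed.

HB.instance Definition _ := gen_eqMixin (modhom M N).
HB.instance Definition _ := gen_choiceMixin (modhom M N).

Definition modhom0 : modhom M N :=
  @ModHom C M N (fun A => \0%R) (fun A B f x => esym (raddf0 (mmap N f))).

Fact modhomD_nat (s t : modhom M N) A B (f : phom A B) x :
  (s B \+ t B) (mmap M f x) = mmap N f ((s A \+ t A) x).
Proof. by rewrite /= !mh_nat raddfD. Qed.

Definition modhomD (s t : modhom M N) : modhom M N :=
  @ModHom C M N (fun A => s A \+ t A) (modhomD_nat s t).

Fact modhomN_nat (s : modhom M N) A B (f : phom A B) x :
  (\- s B) (mmap M f x) = mmap N f ((\- s A) x).
Proof. by rewrite /= !mh_nat raddfN. Qed.

Definition modhomN (s : modhom M N) : modhom M N :=
  @ModHom C M N (fun A => \- s A) (modhomN_nat s).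

Fact modhomDA : associative modhomD.
Proof. by move=> x y z; apply: modhom_ext => A u /=; rewrite addrA. Qed.
Fact modhomDC : commutative modhomD.
Proof. by move=> x y; apply: modhom_ext => A u /=; rewrite addrC. Qed.
Fact modhom0D : left_id modhom0 modhomD.
Proof. by move=> x; apply: modhom_ext => A u /=; rewrite add0r. Qed.
Fact modhomND : left_inverse modhom0 modhomN modhomD.
Proof. by move=> x; apply: modhom_ext => A u /=; rewrite addNr. Qed.
HB.instance Definition _ :=
  GRing.isZmodule.Build (modhom M N) modhomDA modhomDC modhom0D modhomND.

End ModHom.

Definition modid (C : preadditive) (M : Mod C) : modhom M M :=
  @ModHom C M M (fun A => idfun) (fun A B f x => erefl).

Section ModComp.
Context (C : preadditive) (M N P : Mod C) (t : modhom N P) (s : modhom M N).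

Fact modcomp_nat A B (f : phom A B) x :
  (t B \o s B) (mmap M f x) = mmap P f ((t A \o s A) x).
Proof. by rewrite /= !mh_nat. Qed.

Definition modcomp : modhom M P :=
  @ModHom C M P (fun A => t A \o s A) modcomp_nat.

End ModComp.

Definition restrict (C D : preadditive) (F : addfunctor C D) (M : Mod D) : Mod C.
Proof.
apply: (@MkMod C (fun A => M (F A)) (fun A B f => mmap M (afmap F f))).
- by move=> A x; rewrite afmap1 mmap1.
- by move=> A B E g f x; rewrite afmapM mmapM.
- by move=> A B f g x; rewrite raddfD mmapD.
Defined.

Definition restrict_hom (C D : preadditive) (F : addfunctor C D) (M N : Mod D)
    (s : modhom M N) : modhom (restrict F M) (restrict F N) :=
  @ModHom C (restrict F M) (restrict F N) (fun A => s (F A))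
    (fun A B f x => mh_nat s (afmap F f) x).

Definition corep (D : preadditive) (X : D) : Mod D.
Proof.
apply: (@MkMod D (fun A => phom X A) (fun A B f => postcomp X f)).
- by move=> A x /=; rewrite pcomp1f.
- by move=> A B E g f x /=; rewrite pcompA.
- by move=> A B f g x /=; rewrite pcompDl.
Defined.

Definition corep_hom (D : preadditive) (X Y : D) (h : phom X Y) :
    modhom (corep Y) (corep X) :=
  @ModHom D (corep Y) (corep X) (fun A => precomp A h)
    (fun A B f x => esym (pcompA f x h)).

Section ModSum.
Context (C : preadditive) (I : choiceType) (M : I -> Mod C).

Definition modsum : Mod C.
Proof.
apply: (@MkMod C (fun A => dsum (fun i => M i A))
  (fun A B f => dsum_map (fun i => mmap (M i) f))).
- by move=> A x; apply: dsum_ext => i /=; rewrite mmap1.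
- by move=> A B E g f x; apply: dsum_ext => i /=; rewrite mmapM.
- by move=> A B f g x; apply: dsum_ext => i /=; rewrite mmapD.
Defined.

Context (N : Mod C) (s : forall i, modhom (M i) N).

Definition modsum_desc : modhom modsum N.
Proof.
apply: (@ModHom C modsum N (fun A => dsum_desc (fun i => s i A))).
move=> A B f x.
pose D := [set i | x i != 0].
have fD : finite_set D := dsum_fin x.
rewrite /= (@dsum_desc_widen _ _ _ _ _ D)//; last first.
  by move=> i /=; apply: contra_neq => ->; exact: raddf0.
rewrite (@dsum_desc_widen _ _ _ _ _ D)// !fsbig_finite// raddf_sum.
by apply: eq_bigr => i _; rewrite mh_nat.
Defined.

End ModSum.

Section ModImage.
Context (C : preadditive) (M N : Mod C) (s : modhom M N).

Definition modimage_map (A B : C) (f : phom A B) :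
  {additive subgroup (image_sub (s A)) -> subgroup (image_sub (s B))}.
Proof.
refine (corestr (f := mmap N f \o val) _).
case=> y /= /image_subP[x <-]; apply/image_subP.
by exists (mmap M f x); rewrite mh_nat.
Defined.

Definition modimage : Mod C.
Proof.
apply: (@MkMod C (fun A => subgroup (image_sub (s A))) modimage_map).
- by move=> A x; apply: val_inj; rewrite /= mmap1.
- by move=> A B E g f x; apply: val_inj; rewrite /= mmapM.
- by move=> A B f g x; apply: val_inj; rewrite /= mmapD.
Defined.

End ModImage.

Section Tensor.
Context (C : preadditive) (A : Mod (opcat C)) (B : Mod C).

Definition tgen : Type := {c : C & (A c * B c)%type}.

Definition tfree : zmodType := {freeg {classic tgen}}.

Definition tsym (c : C) (a : A c) (b : B c) : tfree :=
  << (existT (fun c => (A c * B c)%type) c (a, b) : {classic tgen}) >>.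

(* The relations of the coend: biadditivity and balancing. *)
Inductive trel : tfree -> Prop :=
| TrelDl c (a a' : A c) (b : B c) :
    trel (tsym (a + a') b - (tsym a b + tsym a' b))
| TrelDr c (a : A c) (b b' : B c) :
    trel (tsym a (b + b') - (tsym a b + tsym a b'))
| TrelM c c' (f : @phom C c c') (a : A c') (b : B c) :
    trel (tsym (mmap A (f : @phom (opcat C) c' c) a) b - tsym a (mmap B f b)).

Definition tensor : zmodType := Quotient.quot (gen_sub trel).

Definition tpure (c : C) (a : A c) (b : B c) : tensor :=
  qproj (gen_sub trel) (tsym a b).

Lemma tpureDl c (a a' : A c) (b : B c) :
  tpure (a + a') b = tpure a b + tpure a' b.
Proof.
by rewrite /tpure -raddfD; apply/qproj_eq/mem_gen_sub; exact: TrelDl.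
Qed.

Lemma tpureDr c (a : A c) (b b' : B c) :
  tpure a (b + b') = tpure a b + tpure a b'.
Proof.
by rewrite /tpure -raddfD; apply/qproj_eq/mem_gen_sub; exact: TrelDr.
Qed.

Lemma tpureM c c' (f : @phom C c c') (a : A c') (b : B c) :
  tpure (mmap A (f : @phom (opcat C) c' c) a) b = tpure a (mmap B f b).
Proof. by apply/qproj_eq/mem_gen_sub; exact: TrelM. Qed.

Lemma tensor_ext (V : zmodType) (s t : {additive tensor -> V}) :
  (forall c (a : A c) (b : B c), s (tpure a b) = t (tpure a b)) ->
  forall x, s x = t x.
Proof.
move=> st x; rewrite -[x]qprojK; move: (repr x) => {}x.
rewrite -[x]freeg_sumE !raddf_sum /=; apply: eq_bigr => -[c [a b]] _.
move: (coeff _ _) => n.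
have -> : << n *g (existT _ c (a, b) : {classic tgen}) >> = tsym a b *~ n.
  by rewrite /tsym freegU_mulz intz.
by rewrite !raddfMz [X in X *~ _]st.
Qed.

End Tensor.

Section TensorMap.
Context (C : preadditive) (A A' : Mod (opcat C)) (B B' : Mod C).
Context (s : modhom A A') (t : modhom B B').

Definition tmap_free_fun : tfree A B -> tfree A' B' :=
  fglift (fun x : {classic tgen A B} =>
    tsym (s (tag x) (tagged x).1) (t (tag x) (tagged x).2)).

Fact tmap_free_funD x y :
  tmap_free_fun (x + y) = tmap_free_fun x + tmap_free_fun y.
Proof.
have fB := lift_is_additive (fun x : {classic tgen A B} =>
    tsym (s (tag x) (tagged x).1) (t (tag x) (tagged x).2)).
have f0 : tmap_free_fun 0 = 0 by rewrite -(subrr 0) /tmap_free_fun fB subrr.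
have fN z : tmap_free_fun (- z) = - tmap_free_fun z.
  by rewrite -[- z]add0r /tmap_free_fun fB -/tmap_free_fun f0 add0r.
by rewrite -{1}[y]opprK /tmap_free_fun fB -/tmap_free_fun fN opprK.
Qed.

Definition tmap_free : {additive tfree A B -> tensor A' B'} :=
  qproj _ \o addmap tmap_free_fun tmap_free_funD.

Lemma tmap_freeE c (a : A c) (b : B c) :
  tmap_free (tsym a b) = tpure (s c a) (t c b).
Proof. by rewrite /= /tmap_free_fun /tsym liftU scale1r. Qed.

Fact tmap_free_ker x : x \in gen_sub (@trel C A B) -> tmap_free x = 0.
Proof.
apply: gen_sub_ker => {}x [c a a' b|c a b b'|c c' f a b].
- by rewrite raddfB (raddfD tmap_free) !tmap_freeE (raddfD (s c)) tpureDl subrr.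
- by rewrite raddfB (raddfD tmap_free) !tmap_freeE (raddfD (t c)) tpureDr subrr.
- by rewrite raddfB !tmap_freeE !mh_nat tpureM subrr.
Qed.

Definition tmap : {additive tensor A B -> tensor A' B'} := qlift tmap_free_ker.

Lemma tmapE c (a : A c) (b : B c) : tmap (tpure a b) = tpure (s c a) (t c b).
Proof. by rewrite /tmap qliftE tmap_freeE. Qed.

End TensorMap.

Section TensorMapTheory.
Context (C : preadditive).

Lemma tmap_id (A : Mod (opcat C)) (B : Mod C) x : tmap (modid A) (modid B) x = x.
Proof.
apply: (@tensor_ext _ _ _ _ (tmap _ _) idfun) => c a b.
exact: tmapE.
Qed.

Lemma tmap_comp (A A' A'' : Mod (opcat C)) (B B' B'' : Mod C)
    (s' : modhom A' A'') (s : modhom A A') (t' : modhom B' B'') (t : modhom B B') x :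
  tmap (modcomp s' s) (modcomp t' t) x = tmap s' t' (tmap s t x).
Proof.
apply: (@tensor_ext _ _ _ _ (tmap _ _) (tmap s' t' \o tmap s t)) => c a b.
by rewrite -[RHS]/(tmap s' t' (tmap s t (tpure a b))) !tmapE.
Qed.

Lemma tmapDl (A A' : Mod (opcat C)) (B B' : Mod C) (s s' : modhom A A')
    (t : modhom B B') x :
  tmap (s + s') t x = tmap s t x + tmap s' t x.
Proof.
apply: (@tensor_ext _ _ _ _ (tmap _ _) (tmap s t \+ tmap s' t)) => c a b.
rewrite -[RHS]/(tmap s t (tpure a b) + tmap s' t (tpure a b)) !tmapE.
exact: tpureDl.
Qed.

End TensorMapTheory.

Record category := Category {
  cob :> Type;
  chom : cob -> cob -> Type;
  cid : forall X, chom X X;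
  ccomp : forall X Y Z, chom Y Z -> chom X Y -> chom X Z;
  ccompA : forall X Y Z W (h : chom Z W) (g : chom Y Z) (f : chom X Y),
    ccomp h (ccomp g f) = ccomp (ccomp h g) f;
  ccomp1f : forall X Y (f : chom X Y), ccomp (cid Y) f = f;
  ccompf1 : forall X Y (f : chom X Y), ccomp f (cid X) = f
}.
Arguments chom {c}.
Arguments cid {c}.
Arguments ccomp {c X Y Z}.

Record functor (X Y : category) := Functor {
  fob :> X -> Y;
  fmap : forall A B, chom A B -> chom (fob A) (fob B);
  fmap1 : forall A, fmap (cid A) = cid (fob A);
  fmapM : forall A B D (g : chom B D) (f : chom A B),
    fmap (ccomp g f) = ccomp (fmap g) (fmap f)
}.
Arguments fmap {X Y} f0 {A B}.

Definition functor_comp (X Y Z : category) (G : functor Y Z) (F : functor X Y) :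
  functor X Z.
Proof.
apply: (@Functor X Z (fun A => G (F A)) (fun A B f => fmap G (fmap F f))).
- by move=> A; rewrite !fmap1.
- by move=> A B D g f; rewrite !fmapM.
Defined.

Definition adjoint_pair (X Y : category) (F : functor X Y) (G : functor Y X) :
    Prop :=
  exists phi : forall A B, chom (F A) B -> chom A (G B),
    (forall A B, bijective (phi A B)) /\
    (forall A A' B B' (a : chom A' A) (b : chom B B') (u : chom (F A) B),
       phi A' B' (ccomp b (ccomp u (fmap F a))) =
       ccomp (fmap G b) (ccomp (phi A B u) a)).

Definition is_iso (X : category) (A B : X) (f : chom A B) : Prop :=
  exists g : chom B A, ccomp g f = cid A /\ ccomp f g = cid B.

Definition naturally_isomorphic (X Y : category) (F G : functor X Y) : Prop :=
  exists eta : forall A, chom (F A) (G A),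
    (forall A B (f : chom A B), ccomp (fmap G f) (eta A) = ccomp (eta B) (fmap F f))
    /\ (forall A, is_iso (eta A)).

Definition full_subcategory (X : category) (P : X -> Prop) : category :=
  @Category {A : X | P A} (fun A B => chom (sval A) (sval B))
    (fun A => cid (sval A)) (fun A B D g f => ccomp g f)
    (fun A B D E h g f => ccompA h g f)
    (fun A B f => ccomp1f f) (fun A B f => ccompf1 f).

Definition ModCat (C : preadditive) : category.
Proof.
apply: (@Category (Mod C) (@modhom C) (@modid C)
         (fun M N P t s => modcomp t s)).
- by move=> M N P Q h g f; apply: modhom_ext.
- by move=> M N f; apply: modhom_ext.
- by move=> M N f; apply: modhom_ext.
Defined.

Section IdealFunctors.
Context (C : preadditive) (I : ideal C).

Local Notation CI := (quot_cat I).
Local Notation pi := (quot_functor I).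

Definition pi_lower : functor (ModCat CI) (ModCat C).
Proof.
apply: (@Functor (ModCat CI) (ModCat C) (fun M => restrict pi M)
          (fun M N s => restrict_hom pi s)).
- by move=> M; apply: modhom_ext.
- by move=> M N P t s; apply: modhom_ext.
Defined.

(* M_X = Hom_C(X,-)/I(X,-), i.e. Hom_{C/I}(X, pi -) regarded as a functor on C;
   quot_contra X = Hom_C(-,X)/I(-,X) is its contravariant counterpart. *)
Definition quot_cov (X : CI) : Mod C := restrict pi (corep X).

Definition quot_cov_hom (X Y : CI) (h : phom X Y) :
    modhom (quot_cov Y) (quot_cov X) :=
  restrict_hom pi (corep_hom h).

Definition quot_contra (X : CI) : Mod (opcat C) :=
  restrict (opfunctor pi) (@corep (opcat CI) X).

Definition quot_contra_hom (X Y : CI) (h : phom X Y) :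
    modhom (quot_contra X) (quot_contra Y) :=
  restrict_hom (opfunctor pi) (@corep_hom (opcat CI) Y X h).

Definition pi_upper_ob (M : Mod C) : Mod CI.
Proof.
apply: (@MkMod CI (fun X => tensor (quot_contra X) M)
          (fun X Y h => tmap (quot_contra_hom h) (modid M))).
- move=> X x; rewrite -[RHS]tmap_id; congr (tmap _ _ x).
  by apply: modhom_ext => A a /=; rewrite quot_comp1f.
- move=> X Y Z g f x; rewrite -tmap_comp; congr (tmap _ _ x).
    by apply: modhom_ext => A a /=; rewrite quot_compA.
  exact: modhom_ext.
- move=> X Y f g x; rewrite -tmapDl; congr (tmap _ _ x).
  by apply: modhom_ext => A a /=; rewrite quot_compDl.
Defined.

Definition pi_upper_hom (M N : Mod C) (s : modhom M N) :
  modhom (pi_upper_ob M) (pi_upper_ob N).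
Proof.
apply: (@ModHom CI (pi_upper_ob M) (pi_upper_ob N)
          (fun X => tmap (modid (quot_contra X)) s)).
move=> X Y f.
move=> x; rewrite -!tmap_comp; congr (tmap _ _ x); exact: modhom_ext.
Defined.

Definition pi_upper : functor (ModCat C) (ModCat CI).
Proof.
apply: (@Functor (ModCat C) (ModCat CI) pi_upper_ob pi_upper_hom).
- by move=> M; apply: modhom_ext => X x; exact: tmap_id.
- move=> M N P t s; apply: modhom_ext => X x.
  rewrite -[RHS]tmap_comp; congr (tmap _ _ x); exact: modhom_ext.
Defined.

Definition pi_shriek_map (M : Mod C) (X Y : CI) (h : phom X Y) :
    {additive modhom (quot_cov X) M -> modhom (quot_cov Y) M}.
Proof.
refine (addmap (fun s => modcomp s (quot_cov_hom h)) _).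
by move=> s t; apply: modhom_ext.
Defined.

Definition pi_shriek_ob (M : Mod C) : Mod CI.
Proof.
apply: (@MkMod CI (fun X => modhom (quot_cov X) M) (pi_shriek_map M)).
- by move=> X s; apply: modhom_ext => A x /=; rewrite quot_compf1.
- by move=> X Y Z g f s; apply: modhom_ext => A x /=; rewrite quot_compA.
- move=> X Y f g s; apply: modhom_ext => A x /=.
  by rewrite quot_compDr raddfD.
Defined.

Definition pi_shriek_hom (M N : Mod C) (t : modhom M N) :
  modhom (pi_shriek_ob M) (pi_shriek_ob N).
Proof.
unshelve refine (@ModHom CI (pi_shriek_ob M) (pi_shriek_ob N)
  (fun X => addmap (fun s : modhom (quot_cov X) M => modcomp t s) _) _).
- by move=> s s'; apply: modhom_ext => A x /=; rewrite raddfD.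
- by move=> X Y f s; apply: modhom_ext.
Defined.

Definition pi_shriek : functor (ModCat C) (ModCat CI).
Proof.
apply: (@Functor (ModCat C) (ModCat CI) pi_shriek_ob pi_shriek_hom).
- by move=> M; apply: modhom_ext => X s; apply: modhom_ext.
- by move=> M N P t s; apply: modhom_ext => X u; apply: modhom_ext.
Defined.

Definition annihilated (F : Mod C) : Prop :=
  forall (A B : C) (f : phom A B), f \in I A B -> forall x, mmap F f x = 0.

Definition AnnCat : category := @full_subcategory (ModCat C) annihilated.

(* trace_gen is M = \bigoplus_X M_X, and trace_can G is the canonical morphism
   M^(Lambda) -> G with Lambda = Hom(M, G): on the summand of index lambda it is
   lambda itself. *)
Definition trace_gen : Mod C := modsum (fun X : {classic pob CI} => quot_cov X).

Definition trace_can (G : Mod C) :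
    modhom (modsum (fun _ : modhom trace_gen G => trace_gen)) G :=
  modsum_desc (fun lambda : modhom trace_gen G => lambda).

Definition trace (G : Mod C) : Mod C := modimage (trace_can G).

Lemma trace_gen_annihilated : annihilated trace_gen.
Proof.
move=> A B f fI x; apply: dsum_ext => X /=.
have -> : qproj (I A B) f = qproj (I A B) 0 by apply/qproj_eq; rewrite subr0.
by rewrite raddf0 -[x X]qprojK -[0 in LHS](raddf0 (qproj (I A B))) quot_compE
           -[pcomp 0 _]/(precomp _ _ 0) !raddf0.
Qed.

Lemma trace_annihilated (G : Mod C) : annihilated (trace G).
Proof.
move=> A B f fI [y yG]; apply: val_inj => /=.
case/image_subP: (yG) => x <-; rewrite -mh_nat.
suff -> : mmap (modsum (fun _ : modhom trace_gen G => trace_gen)) f x = 0.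
  by rewrite raddf0.
by apply: dsum_ext => lambda; exact: trace_gen_annihilated.
Qed.

Lemma mem_trace (G : Mod C) (lambda : modhom trace_gen G) A x :
  lambda A x \in image_sub (trace_can G A).
Proof.
apply/image_subP.
exists (@dsum_in _ (fun _ : modhom trace_gen G => trace_gen A) lambda x).
exact: (dsum_desc_in (fun l : modhom trace_gen G => l A)).
Qed.

Lemma trace_stable (G H : Mod C) (s : modhom G H) A y :
  y \in image_sub (trace_can G A) -> s A y \in image_sub (trace_can H A).
Proof.
case/image_subP => x <-.
rewrite /= /dsum_desc_fun fsbig_supp fsbig_finite; last first.
  apply: sub_finite_set (dsum_fin x) => i /= [_] ix.
  by apply/eqP => xi0; apply: ix; rewrite xi0 raddf0.
rewrite raddf_sum; apply: rpred_sum => lambda _.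
exact: (mem_trace (modcomp s lambda)).
Qed.

Definition trace_hom (G H : Mod C) (s : modhom G H) :
  modhom (trace G) (trace H).
Proof.
unshelve refine (@ModHom C (trace G) (trace H)
  (fun A => corestr (f := s A \o val) _) _).
- by case=> y yG /=; exact: trace_stable.
- by move=> A B f y; apply: val_inj; rewrite /= mh_nat.
Defined.

Definition trace_ob (G : ModCat C) : AnnCat :=
  exist annihilated (trace G) (@trace_annihilated G).

Definition trace_fmap (G H : ModCat C) (s : chom G H) :
  chom (trace_ob G) (trace_ob H) := trace_hom s.

Definition trace_functor : functor (ModCat C) AnnCat.
Proof.
apply: (@Functor (ModCat C) AnnCat trace_ob trace_fmap).
- by move=> G; apply: modhom_ext => A x; apply: val_inj.
- by move=> G H K t s; apply: modhom_ext => A x; apply: val_inj.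
Defined.

Section Omega.
Context (F : Mod C) (FI : annihilated F).

Definition omega_map_fun (A B : CI) (h : phom A B) : {additive F A -> F B} :=
  mmap F (repr h).

Lemma omega_map_funE (A B : C) (f : phom A B) x :
  omega_map_fun (qproj (I A B) f) x = mmap F f x.
Proof.
apply/eqP; rewrite -subr_eq0; apply/eqP.
have fI : repr (qproj (I A B) f) - f \in I A B by apply/qproj_eq; rewrite qprojK.
rewrite -[RHS](FI fI x) /omega_map_fun; apply/eqP; rewrite subr_eq -mmapD.
by rewrite subrK.
Qed.

Definition omega_ob : Mod CI.
Proof.
apply: (@MkMod CI (fun A => F A) omega_map_fun).
- by move=> A x; rewrite omega_map_funE mmap1.
- move=> A B E g f x; rewrite -[g]qprojK -[f]qprojK [pcomp _ _]quot_compE !omega_map_funE.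
  by rewrite mmapM.
- move=> A B f g x; rewrite -[g]qprojK -[f]qprojK -raddfD !omega_map_funE.
  by rewrite mmapD.
Defined.

End Omega.

Definition omega_hom (F G : AnnCat) (s : chom F G) :
  modhom (omega_ob (svalP F)) (omega_ob (svalP G)) :=
  @ModHom CI (omega_ob (svalP F)) (omega_ob (svalP G)) (fun A => s A)
    (fun A B f x => mh_nat s (repr f) x).

Definition omega : functor AnnCat (ModCat CI).
Proof.
apply: (@Functor AnnCat (ModCat CI) (fun F => omega_ob (svalP F)) omega_hom).
- by move=> F; apply: modhom_ext.
- by move=> F G H t s; apply: modhom_ext.
Defined.

Lemma restrict_annihilated (F : Mod CI) : annihilated (restrict pi F).
Proof.
move=> A B f fI x /=.
have -> : qproj (I A B) f = 0.
  by rewrite -[RHS](raddf0 (qproj (I A B))); apply/qproj_eq; rewrite subr0.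
exact: (@mmap0 CI F A B x).
Qed.

(* On morphisms both pi_lower and omega keep the components, so the next two
   lemmas say that omega is the inverse of pi_lower : Mod(C/I) -> Ann(I). *)
Lemma omegaK (F : Mod C) (FI : annihilated F) : restrict pi (omega_ob FI) = F.
Proof.
case: F FI => F m m1 mM mD FI.
apply: Mod_ext => A B f x; exact: omega_map_funE.
Qed.

Lemma restrictK (F : Mod CI) : omega_ob (@restrict_annihilated F) = F.
Proof.
case: F => F m m1 mM mD.
apply: Mod_ext => A B f x /=.
by rewrite /omega_map_fun /= [qproj _ _]reprK.
Qed.

Definition trace_bar : functor (ModCat C) (ModCat CI) :=
  functor_comp omega trace_functor.

End IdealFunctors.

(* Main.v *)
From mathcomp Require Import all_boot all_algebra.
From mathcomp Require Import boolp freeg.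
Require Import Defs.

Set Implicit Arguments.
Unset Strict Implicit.
Unset Printing Implicit Defensive.

Import GRing.Theory.
Local Open Scope ring_scope.

(** Write M_X for the functor Hom_C(X,-)/I(X,-).  It is the representable
functor of X on C/I, restricted along pi, so all three claims rest on the
Yoneda lemma over C/I: a morphism out of a representable is
determined by its value on an identity.

For the extension (C/I) (x)_C -, a morphism u : pi^* M -> N corresponds to
x |-> u(1 (x) x) and, backwards, s : M -> pi_* N corresponds to
q (x) x |-> N(q)(s x).  The latter is well defined by the universal property of
the tensor product (tlift), and the two are inverse to each other because
q (x) x = (pi^* M)(q)(1 (x) x): the elements 1 (x) x generate pi^* M over C/I.

For the coextension, u : pi_* N -> M corresponds to the morphism sending x in
N(X) to the composite of M_X -> pi_* N, q |-> N(q)(x), with u; backwards, v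
corresponds to x |-> v(x)(1).

Finally pi^! M and the trace are compared by evaluation at the identity,
s : M_X -> M going to s(1).  This value lies in the trace because s extends to
the direct sum of all M_Y by projecting to the summand M_X
(quot_cov_value_trace).  Conversely the trace is a module over C/I, so each of
its elements y in degree X is the image of 1 under a morphism from M_X to the
trace, which composed with the inclusion gives back an element of pi^! M.
Hence the inverse of evaluation is the transpose, under the second adjunction,
of the inclusion of the trace in M (eval_id_iso). *)

(** * The universal property of the tensor product of functors *)

Section TensorLift.
Context (C : preadditive) (A : Mod (opcat C)) (B : Mod C) (V : zmodType).
Context (beta : forall c : C, A c -> B c -> V).
Hypothesis betaDl : forall (c : C) (a a' : A c) (b : B c),
  beta (a + a') b = beta a b + beta a' b.
Hypothesis betaDr : forall (c : C) (a : A c) (b b' : B c),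
  beta a (b + b') = beta a b + beta a b'.
Hypothesis betaM : forall c c' (f : @phom C c c') (a : A c') (b : B c),
  beta (mmap A (f : @phom (opcat C) c' c) a) b = beta a (mmap B f b).

(* fglift needs a module over the integers as its target, hence zmodule V. *)
Definition tlift_free_fun (x : tfree A B) : V :=
  fglift (fun t : {classic tgen A B} =>
    beta (tagged t).1 (tagged t).2 : zmodule V) x.

Fact tlift_free_funD x y :
  tlift_free_fun (x + y) = tlift_free_fun x + tlift_free_fun y.
Proof.
have fB : zmod_morphism tlift_free_fun := @lift_is_additive _ _ (zmodule V) _.
have f0 : tlift_free_fun 0 = 0 by rewrite -(subrr 0) fB subrr.
have fN z : tlift_free_fun (- z) = - tlift_free_fun z.
  by rewrite -[- z]add0r fB f0 add0r.
by rewrite -{1}[y]opprK fB fN opprK.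
Qed.

Definition tlift_free : {additive tfree A B -> V} :=
  addmap tlift_free_fun tlift_free_funD.

Lemma tlift_freeE c (a : A c) (b : B c) : tlift_free (tsym a b) = beta a b.
Proof. by rewrite /= /tlift_free_fun /tsym liftU scale1r. Qed.

Fact tlift_free_ker x : x \in gen_sub (@trel C A B) -> tlift_free x = 0.
Proof.
apply: gen_sub_ker => {}x [c a a' b|c a b b'|c c' f a b].
- by rewrite raddfB (raddfD tlift_free) !tlift_freeE betaDl subrr.
- by rewrite raddfB (raddfD tlift_free) !tlift_freeE betaDr subrr.
- by rewrite raddfB !tlift_freeE betaM subrr.
Qed.

Definition tlift : {additive tensor A B -> V} := qlift tlift_free_ker.

Lemma tliftE c (a : A c) (b : B c) : tlift (tpure a b) = beta a b.
Proof. by rewrite /tlift qliftE tlift_freeE. Qed.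

End TensorLift.

(** * Morphisms out of a representable functor *)

Section Yoneda.
Context (D : preadditive) (N : Mod D) (X : D).

Definition orbit_map (x : N X) (A : D) : {additive phom X A -> N A} :=
  addmap (fun q : phom X A => mmap N q x) (fun f g => mmapD f g x).

Definition yoneda (x : N X) : modhom (corep X) N :=
  @ModHom D (corep X) N (orbit_map x) (fun A B f q => mmapM f q x).

End Yoneda.

(** * The adjunction between extension and restriction *)

Section QuotientAdjunctions.
Context (C : preadditive) (I : ideal C).
Local Notation CI := (quot_cat I).
Local Notation pi := (quot_functor I).

(** Stated with quot_contra and pcomp of C/I displayed, so that it can be used
for rewriting where simplification would unfold them into cosets. *)
Lemma pi_upper_ob_tpure (M : Mod C) (X Y : CI) (h : phom X Y) (A : C)
    (q : @phom CI A X) (x : M A) :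
  mmap (pi_upper_ob I M) h (@tpure C (quot_contra X) M A q x) =
  @tpure C (quot_contra Y) M A (pcomp h q) x.
Proof. exact: tmapE. Qed.

Section ExtensionTranspose.
Context (M : Mod C) (N : Mod CI).

Definition upper_transpose_map (u : modhom (pi_upper_ob I M) N) (A : C) :
  {additive M A -> N A} :=
  addmap (fun x : M A => u A (@tpure C (quot_contra (A : CI)) M A (pid (A : CI)) x))
    (fun x y => etrans (congr1 (u A) (tpureDr _ x y)) (raddfD (u A) _ _)).

(** Balancing moves f across the tensor sign: 1 (x) M(f) x = f (x) x, and the
latter is the image of 1 (x) x under pi f. *)
Fact upper_transpose_nat u (A B : C) (f : phom A B) x :
  upper_transpose_map u B (mmap M f x) =
  mmap (restrict pi N) f (upper_transpose_map u A x).
Proof.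
rewrite /= -[RHS](@mh_nat CI _ _ u A B (qproj (I A B) f)) pi_upper_ob_tpure.
rewrite -tpureM; congr (u B (tpure _ _)).
by rewrite [LHS](@pcomp1f CI) [RHS](@pcompf1 CI).
Qed.

Definition upper_transpose u : modhom M (restrict pi N) :=
  @ModHom C M (restrict pi N) (upper_transpose_map u) (upper_transpose_nat u).

Context (s : modhom M (restrict pi N)).

Definition upper_untranspose_map (X : CI) :
  {additive tensor (quot_contra X) M -> N X}.
Proof.
refine (@tlift C (quot_contra X) M (N X)
  (fun c (q : @phom CI c X) (x : M c) => mmap N q (s c x)) _ _ _).
- by move=> c q q' x; exact: mmapD.
- by move=> c q x y; rewrite !raddfD.
- by move=> c c' f q x /=; rewrite mh_nat [LHS]mmapM.
Defined.

Lemma upper_untranspose_mapE (X : CI) (c : C) (q : @phom CI c X) (x : M c) :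
  upper_untranspose_map X (@tpure C (quot_contra X) M c q x) = mmap N q (s c x).
Proof. exact: tliftE. Qed.

Fact upper_untranspose_nat (X Y : CI) (h : phom X Y) z :
  upper_untranspose_map Y (mmap (pi_upper_ob I M) h z) =
  mmap N h (upper_untranspose_map X z).
Proof.
apply: (@tensor_ext _ _ _ _ (upper_untranspose_map Y \o mmap (pi_upper_ob I M) h)
  (mmap N h \o upper_untranspose_map X)) => c q x.
transitivity (upper_untranspose_map Y (@tpure C (quot_contra Y) M c (pcomp h q) x)).
  exact: congr1 (pi_upper_ob_tpure h q x).
rewrite upper_untranspose_mapE mmapM.
exact: congr1 (esym (upper_untranspose_mapE q x)).
Qed.

Definition upper_untranspose : modhom (pi_upper_ob I M) N :=
  @ModHom CI (pi_upper_ob I M) N upper_untranspose_map upper_untranspose_nat.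

End ExtensionTranspose.

Lemma upper_transposeK (M : Mod C) (N : Mod CI) :
  cancel (@upper_transpose M N) (@upper_untranspose M N).
Proof.
move=> u; apply: modhom_ext => X z.
apply: (@tensor_ext _ _ _ _ (upper_untranspose_map (upper_transpose u) X) (u X)).
move=> c q x.
rewrite upper_untranspose_mapE /= -[LHS](@mh_nat CI _ _ u c X q) pi_upper_ob_tpure.
by congr (u X (tpure _ _)); exact: (@pcompf1 CI).
Qed.

Lemma upper_untransposeK (M : Mod C) (N : Mod CI) :
  cancel (@upper_untranspose M N) (@upper_transpose M N).
Proof.
move=> s; apply: modhom_ext => A x.
by rewrite /= [LHS]upper_untranspose_mapE [LHS]mmap1.
Qed.

Lemma pi_upper_lower_adjoint : adjoint_pair (pi_upper I) (pi_lower I).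
Proof.
exists (fun M N => @upper_transpose M N); split.
  move=> M N; exact: Bijective (@upper_transposeK M N) (@upper_untransposeK M N).
move=> M M' N N' a b u; apply: modhom_ext => A x.
apply: (congr1 (fun z => b A (u A z))).
exact: (tmapE (modid (quot_contra (A : CI))) a).
Qed.

(** * The adjunction between restriction and coextension *)

Section CoextensionTranspose.
Context (N : Mod CI) (M : Mod C).

Definition shriek_transpose_map (u : modhom (restrict pi N) M) (X : CI) :
  {additive N X -> modhom (quot_cov X) M}.
Proof.
refine (addmap (fun x => modcomp u (restrict_hom pi (yoneda x))) _).
by move=> x y; apply: modhom_ext => A q /=; rewrite !raddfD.
Defined.

Fact shriek_transpose_nat u (X Y : CI) (h : phom X Y) x :
  shriek_transpose_map u Y (mmap N h x) =
  mmap (pi_shriek_ob I M) h (shriek_transpose_map u X x).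
Proof.
by apply: modhom_ext => A q /=; congr (u A _); rewrite -mmapM.
Qed.

Definition shriek_transpose u : modhom N (pi_shriek_ob I M) :=
  @ModHom CI N (pi_shriek_ob I M) (shriek_transpose_map u)
    (shriek_transpose_nat u).

Context (v : modhom N (pi_shriek_ob I M)).

Definition shriek_untranspose_map (A : C) : {additive N A -> M A}.
Proof.
refine (addmap (fun x => v A x A (pid (A : CI))) _).
by move=> x y; rewrite raddfD.
Defined.

(** Both sides equal v(x)(pi f): on the left by naturality of v in the object,
on the right by naturality of the morphism v(x) itself. *)
Fact shriek_untranspose_nat (A B : C) (f : phom A B) x :
  shriek_untranspose_map B (mmap (restrict pi N) f x) =
  mmap M f (shriek_untranspose_map A x).
Proof.
transitivity (v A x B (qproj (I A B) f)).
  rewrite -[LHS]/(v B (mmap N _ x) B _) mh_nat.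
  by congr (v A x B _); exact: (@pcomp1f CI).
rewrite -[RHS](@mh_nat C _ _ (v A x)).
by congr (v A x B _); rewrite [RHS](@pcompf1 CI).
Qed.

Definition shriek_untranspose : modhom (restrict pi N) M :=
  @ModHom C (restrict pi N) M shriek_untranspose_map shriek_untranspose_nat.

End CoextensionTranspose.

Lemma shriek_transposeK (N : Mod CI) (M : Mod C) :
  cancel (@shriek_transpose N M) (@shriek_untranspose N M).
Proof. by move=> u; apply: modhom_ext => A x /=; rewrite [mmap _ _ _]mmap1. Qed.

Lemma shriek_untransposeK (N : Mod CI) (M : Mod C) :
  cancel (@shriek_untranspose N M) (@shriek_transpose N M).
Proof.
move=> v; apply: modhom_ext => X x; apply: modhom_ext => A q /=.
by rewrite mh_nat /=; congr (v X x A _); exact: (@pcomp1f CI).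
Qed.

Lemma pi_lower_shriek_adjoint : adjoint_pair (pi_lower I) (pi_shriek I).
Proof.
exists (fun N M => @shriek_transpose N M); split.
  move=> N M; exact: Bijective (@shriek_transposeK N M) (@shriek_untransposeK N M).
move=> N N' M M' a b u; apply: modhom_ext => X x; apply: modhom_ext => A q /=.
congr (b A (u A _)); exact: (mh_nat a q x).
Qed.

(** * Coextension is the trace *)

Section TraceComparison.
Context (M : Mod C).
Local Notation trM := (trace_bar I M).

Definition trace_gen_proj (X : CI) : modhom (trace_gen I) (quot_cov X) :=
  @ModHom C (trace_gen I) (quot_cov X)
    (fun A => addmap (fun x : trace_gen I A => x X) (fun x y => erefl))
    (fun A B f x => erefl).

(** The trace is spanned by the values of morphisms defined on the whole sum of
the M_Y, while s is defined on the single summand M_X; composing s with the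
projection to that summand closes the gap. *)
Lemma quot_cov_value_trace (X : CI) (s : modhom (quot_cov X) M) (A : C)
    (q : quot_cov X A) : s A q \in image_sub (trace_can I M A).
Proof.
have := mem_trace (modcomp s (trace_gen_proj X))
  (@dsum_in _ (fun Y : {classic pob CI} => @quot_cov C I Y A) X q).
by rewrite /= dfwith_in.
Qed.

Definition eval_id_map (X : CI) :
  {additive modhom (quot_cov X) M -> (trM : Mod CI) X}.
Proof.
refine (@addmap (modhom (quot_cov X) M) (subgroup (image_sub (trace_can I M X)))
  (fun s => exist _ (s X (pid X)) (quot_cov_value_trace s (pid X))) _).
by move=> s t; apply: val_inj.
Defined.

Fact trace_incl_nat (A B : C) (f : phom A B) (y : restrict pi trM A) :
  val (mmap (restrict pi trM) f y) = mmap M f (val y).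
Proof.
by rewrite [mmap _ f y](omega_map_funE (@trace_annihilated C I M) f y).
Qed.

Definition trace_incl : modhom (restrict pi trM) M :=
  @ModHom C (restrict pi trM) M (fun A => val) trace_incl_nat.

(** At h = 1 this is the definition of eval_id_map; for general h it says that
the trace element s(1) remembers all of s, which yields both naturality and
left invertibility of the evaluation. *)
Lemma val_trace_eval (X Y : CI) (h : phom X Y) (s : modhom (quot_cov X) M) :
  val (mmap (trM : Mod CI) h (eval_id_map X s)) = s Y h.
Proof.
rewrite -[h]qprojK; set f := repr h.
transitivity (mmap M f (s X (pid X))); first exact: trace_incl_nat.
by rewrite -[LHS](@mh_nat C _ _ s); congr (s Y _); exact: (@pcompf1 CI).
Qed.

Fact eval_id_nat (X Y : CI) (h : phom X Y) s :
  eval_id_map Y (mmap (pi_shriek_ob I M) h s) =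
  mmap (trM : Mod CI) h (eval_id_map X s).
Proof.
apply: val_inj; rewrite val_trace_eval /=.
by congr (s Y _); exact: (@pcomp1f CI).
Qed.

Definition eval_id : modhom (pi_shriek_ob I M) trM :=
  @ModHom CI (pi_shriek_ob I M) trM eval_id_map eval_id_nat.

Lemma eval_id_iso : @is_iso (ModCat CI) _ _ eval_id.
Proof.
exists (shriek_transpose trace_incl); split.
  apply: modhom_ext => X s; apply: modhom_ext => A q.
  exact: val_trace_eval.
apply: modhom_ext => X y; apply: val_inj.
exact: (congr1 val (@mmap1 CI (trace_bar I M) X y)).
Qed.

End TraceComparison.

Lemma pi_shriek_trace_iso : naturally_isomorphic (pi_shriek I) (trace_bar I).
Proof.
exists eval_id; split=> [M N t|]; last exact: eval_id_iso.
by apply: modhom_ext => X s; apply: val_inj.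
Qed.

End QuotientAdjunctions.

Theorem proposition3p11 (C : preadditive) (I : ideal C) :
  adjoint_pair (pi_upper I) (pi_lower I) /\
  adjoint_pair (pi_lower I) (pi_shriek I) /\
  naturally_isomorphic (pi_shriek I) (trace_bar I).
Proof.
split; first exact: pi_upper_lower_adjoint.
split; [exact: pi_lower_shriek_adjoint | exact: pi_shriek_trace_iso].
Qed.
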